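(* Let $p\ge 2$ be a constant and $0<\alpha,\varepsilon<1$. In the coordinator model where site $i\in[k]$ holds $v^{(i)}\in\mathbb Z_{\ge 0}^n$ (entries bounded by $\mathrm{poly}(n)$) and $v=\sum_i v^{(i)}$, let $v^p$ denote the vector $(v_1^p,\dots,v_n^p)$. Then: (1) there is a two-round protocol which, with probability at least $1-\frac1n$, outputs an $(\alpha,0)$-cover of $v^p$ of size $O(1/\alpha)$, using $O\!\left(\frac{k^{p-1}}{\alpha}\log^3 n\right)$ bits of communication; (2) there is a one-round protocol which, with probability at least $1-\frac1n$, outputs an $(\alpha,\varepsilon)$-cover of $v^p$ of size $O(1/\alpha)$, using $O\!\left(\frac{k^{p-1}}{\alpha\varepsilon^p}\log^3 n\right)$ bits of communication.
   Context: Coordinator model: $k$ sites and a coordinator; site $i$ knows only $v^{(i)}$; communication cost is total bits exchanged. For a non-negative vector $u\in\mathbb R^n$, a non-empty set of (index, value) pairs $Q=\{(i_1,w_1),\dots,(i_t,w_t)\}$ is an $(\alpha,\varepsilon)$-cover w.r.t. $u$ if (i) every $i\in[n]$ with $u_i>\alpha\sum_{l}u_l$ appears as an index in $Q$, and (ii) for every $j\in[t]$, $(1-\varepsilon)u_{i_j}\le w_j\le(1+\varepsilon)u_{i_j}$. Constants depending on $p$ are absorbed in the $O(\cdot)$. *)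

(* Defs.v *)
From mathcomp Require Import all_boot all_order all_algebra finmap.
From mathcomp Require Import boolp reals exp.

Set Implicit Arguments.
Unset Strict Implicit.
Unset Printing Implicit Defensive.

Import Order.TTheory GRing.Theory Num.Theory.

Local Open Scope ring_scope.
Local Open Scope fset_scope.

Definition bits := seq bool.

(* A protocol with k sites, site inputs in I and outputs in O.  A round consists
   of one message from every site to the coordinator; between two consecutive
   rounds the coordinator sends one message to every site.  In particular a
   one-round protocol is a simultaneous-message protocol: the coordinator sends
   nothing.  Randomness is private: every party owns [ncoins] fair coins, a
   number fixed independently of the input.  Empty messages are allowed.

   [site_msg i x c d] is the next message of site i on input x with coins c,
   after it has received the messages d (in chronological order) from the
   coordinator.  [coord_msg c h i] and [output c h] are the next message to
   site i, resp. the final output, of the coordinator with coins c, after it has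
   received h, where [nth _ h t] is the family of the messages of round t. *)
Record protocol (k : nat) (I O : Type) := Protocol {
  ncoins : nat;
  site_msg : 'I_k -> I -> ncoins.-tuple bool -> seq bits -> bits;
  coord_msg : ncoins.-tuple bool -> seq ('I_k -> bits) -> 'I_k -> bits;
  output : ncoins.-tuple bool -> seq ('I_k -> bits) -> O
}.

Section Execution.
Variables (k : nat) (I O : Type) (P : protocol k I O).

(* The coins of the coordinator and of the sites. *)
Definition coins : finType :=
  ((ncoins P).-tuple bool * {ffun 'I_k -> (ncoins P).-tuple bool})%type.

(* What site i has received once the coordinator has answered every round
   of h: one message after each nonempty prefix of h. *)
Definition received (w : coins) (h : seq ('I_k -> bits)) (i : 'I_k) : seq bits :=
  [seq coord_msg w.1 (take s h) i | s <- iota 1 (size h)].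

Fixpoint history (x : 'I_k -> I) (w : coins) (r : nat) : seq ('I_k -> bits) :=
  if r is r'.+1 then
    let h := history x w r' in
    rcons h (fun i => site_msg i (x i) (w.2 i) (received w h i))
  else [::].

Definition run (r : nat) (x : 'I_k -> I) (w : coins) : O :=
  output w.1 (history x w r).

(* The coordinator does not answer the last round, whence [r.-1]. *)
Definition communication (r : nat) (x : 'I_k -> I) (w : coins) : nat :=
  (\sum_(m <- history x w r) \sum_(i < k) size (m i) +
   \sum_(i < k) \sum_(m <- received w (history x w r.-1) i) size m)%N.

Definition coin_prob (R : realType) (E : coins -> Prop) : R :=
  #|[set w | `[< E w >]]|%:R / #|coins|%:R.

End Execution.

Definition is_cover (R : realType) (n : nat) (alpha eps : R) (u : 'rV[R]_n)
    (Q : {fset 'I_n * R}) : Prop :=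
  [/\ Q != fset0,
      forall i : 'I_n, alpha * (\sum_l u 0 l) < u 0 i ->
        exists w : R, (i, w) \in Q
    & forall q : 'I_n * R, q \in Q ->
        (1 - eps) * u 0 q.1 <= q.2 <= (1 + eps) * u 0 q.1].

Definition vpow (R : realType) (n : nat) (v : 'rV[nat]_n) (p : R) : 'rV[R]_n :=
  \row_j ((v 0 j)%:R `^ p).

Definition total (k n : nat) (x : 'I_k -> 'rV[nat]_n) : 'rV[nat]_n :=
  \sum_i x i.

(* P, run for r rounds on site vectors with entries at most M, always uses at
   most B bits and, with probability at least 1 - 1/n, outputs an
   (alpha, eps)-cover of v^p with at most S pairs. *)
Definition computes_cover (R : realType) (k n r : nat) (p : R) (M : nat)
    (alpha eps S B : R) (P : protocol k 'rV[nat]_n {fset 'I_n * R}) : Prop :=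
  forall x : 'I_k -> 'rV[nat]_n, (forall i j, (x i ord0 j <= M)%N) ->
    (forall w : coins P, (communication r x w)%:R <= B) /\
    1 - n%:R^-1 <= coin_prob R (fun w : coins P =>
      is_cover alpha eps (vpow (total x) p) (run r x w) /\
      #|` run r x w|%:R <= S).

(* Main.v *)
(** Let site [i] draw coordinates independently with probability proportional to
    the [p]-th powers of its own entries, [q_ij ~ x_ij^p / F_i].  Because
    [sum_i F_i <= F = ||v||_p^p] and [p >= 2], already [T ~ k^(p-2) / (alpha eps^p)]
    draws per site make the importance-weighted estimate of [v_j] accurate up to
    an additive error [eta ~ eps (alpha sum_i F_i)^(1/p)], which is at most about
    [eps v_j] for heavy [j]: sites with [x_ij <= eta / k] change [v_j] by at most
    [eta], so an L1 bound suffices for them, and the others contribute variance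
    [sum_i x_ij^(2-p) F_i / T], which is controlled since [x_ij^(2-p)] is largest
    at the cut-off.  Repeating [O(log n)] times and keeping a value that agrees
    with a majority of the estimates makes all coordinates simultaneously
    accurate.  The coordinator knows [eta], because the sites can afford to send
    [F_i] up to a factor 2.  It keeps the coordinates whose value is well above
    [eta], hence has small relative error, and then those that are
    [Omega(alpha)]-heavy among the kept ones, of which there are [O(1/alpha)].
    With a second round it asks for the exact entries at these coordinates. *)

Require Import Defs.
From mathcomp Require Import all_boot all_order all_algebra finmap.
From mathcomp Require Import boolp reals exp sequences.
From mathcomp Require Import zify ring lra.

Set Implicit Arguments.
Unset Strict Implicit.
Unset Printing Implicit Defensive.

Import Order.TTheory GRing.Theory Num.Theory.

Local Open Scope ring_scope.

(** * Uniform averages over finite types *)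

Section Mean.
Variable R : realType.

Definition mean (T : finType) (f : T -> R) : R := (\sum_t f t) / #|T|%:R.

Lemma eq_mean (T : finType) (f g : T -> R) : f =1 g -> mean f = mean g.
Proof. by move=> fg; rewrite /mean (eq_bigr _ (fun t _ => fg t)). Qed.

Lemma ler_mean (T : finType) (f g : T -> R) :
  (forall t, f t <= g t) -> mean f <= mean g.
Proof. by move=> fg; rewrite ler_wpM2r ?invr_ge0 ?ler0n// ler_sum. Qed.

Lemma meanD (T : finType) (f g : T -> R) :
  mean (fun t => f t + g t) = mean f + mean g.
Proof. by rewrite /mean big_split mulrDl. Qed.

Lemma meanN (T : finType) (f : T -> R) : mean (fun t => - f t) = - mean f.
Proof. by rewrite /mean sumrN mulNr. Qed.

Lemma meanZ (T : finType) (c : R) (f : T -> R) :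
  mean (fun t => c * f t) = c * mean f.
Proof. by rewrite /mean -mulr_sumr mulrA. Qed.

Lemma mean_sum (T I : finType) (P : pred I) (f : I -> T -> R) :
  mean (fun t => \sum_(i | P i) f i t) = \sum_(i | P i) mean (f i).
Proof. by rewrite /mean exchange_big mulr_suml. Qed.

Lemma mean_cst (T : finType) (c : R) : (0 < #|T|)%N -> mean (fun _ : T => c) = c.
Proof.
by move=> T0; rewrite /mean sumr_const -(mulr_natr c) mulfK// pnatr_eq0 -lt0n.
Qed.

Lemma mean_reindex (S T : finType) (h : S -> T) (f : T -> R) :
  bijective h -> mean (fun s => f (h s)) = mean f.
Proof.
move=> hbij; rewrite /mean (bij_eq_card hbij); congr (_ / _).
by rewrite [RHS](reindex h)//; apply: onW_bij.
Qed.

Lemma mean_snd (S T : finType) (f : T -> R) :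
  (0 < #|S|)%N -> mean (fun st : S * T => f st.2) = mean f.
Proof.
move=> S0; rewrite /mean -(pair_bigA _ (fun (_ : S) t => f t))/=.
rewrite sumr_const card_prod natrM -(mulr_natr (\sum_j f j)) invfM mulrA; congr (_ / _).
by rewrite mulfK// pnatr_eq0 -lt0n.
Qed.

(** A uniform function has independent uniform coordinates: distributivity turns the sum over
    functions into a product of sums. The independence facts below follow by setting the other
    factors to 1. *)
Lemma mean_prod (D U : finType) (F : D -> U -> R) :
  mean (fun w : {ffun D -> U} => \prod_d F d (w d)) = \prod_d mean (F d).
Proof.
rewrite /mean -bigA_distr_bigA card_ffun natrX.
by rewrite big_split/= prodr_const exprVn.
Qed.

Lemma mean_coord (D U : finType) (d0 : D) (f : U -> R) : (0 < #|U|)%N ->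
  mean (fun w : {ffun D -> U} => f (w d0)) = mean f.
Proof.
move=> U0; transitivity (\prod_d mean (fun u => if d == d0 then f u else 1)).
  rewrite -mean_prod; apply: eq_mean => w.
  by rewrite -big_mkcond/= big_pred1_eq.
rewrite (bigD1 d0)//= eqxx big1 ?mulr1// => d /negPf ->.
by rewrite mean_cst.
Qed.

Lemma mean_coord2 (D U : finType) (d e : D) (f g : U -> R) :
  (0 < #|U|)%N -> d != e ->
  mean (fun w : {ffun D -> U} => f (w d) * g (w e)) = mean f * mean g.
Proof.
move=> U0 de; transitivity
  (\prod_c mean (fun u => (if c == d then f u else 1) * (if c == e then g u else 1))).
  rewrite -mean_prod; apply: eq_mean => w.
  by rewrite big_split/= -!big_mkcond/= !big_pred1_eq.
have ed : e == d = false by rewrite eq_sym (negPf de).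
rewrite (bigD1 d)//= (bigD1 e) ?ed//= big1 ?mulr1.
  rewrite !eqxx (negPf de); congr (_ * _).
    by apply: eq_mean => u; rewrite mulr1.
  by apply: eq_mean => u; rewrite mul1r.
move=> c /andP[/negPf -> /negPf ->]; rewrite mulr1.
by rewrite mean_cst.
Qed.

Lemma mean_sqr_sum_centered (D U : finType) (P : pred D) (g : D -> U -> R) :
  (0 < #|U|)%N -> (forall d, mean (g d) = 0) ->
  mean (fun w : {ffun D -> U} => (\sum_(d | P d) g d (w d)) ^+ 2) =
  \sum_(d | P d) mean (fun u => g d u ^+ 2).
Proof.
move=> U0 g0.
under eq_mean do rewrite expr2 mulr_suml.
rewrite mean_sum; apply: eq_bigr => d Pd.
under eq_mean do rewrite mulr_sumr.
rewrite mean_sum (bigD1 d)//= big1 ?addr0; last first.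
  by move=> e /andP[_ ed]; rewrite mean_coord2 1?eq_sym// g0 mul0r.
rewrite -(mean_coord d (fun u => g d u ^+ 2) U0).
by apply: eq_mean => w; rewrite expr2.
Qed.

Lemma mean_sqr_center_le (U : finType) (h : U -> R) : (0 < #|U|)%N ->
  mean (fun u => (h u - mean h) ^+ 2) <= mean (fun u => h u ^+ 2).
Proof.
move=> U0; have -> : mean (fun u => (h u - mean h) ^+ 2) =
   mean (fun u => h u ^+ 2) - mean h ^+ 2.
  transitivity (mean (fun u => h u ^+ 2 + ((- (2 * mean h)) * h u + mean h ^+ 2))).
    by apply: eq_mean => u; ring.
  by rewrite meanD meanD meanZ mean_cst//; ring.
by rewrite gerBl sqr_ge0.
Qed.

(* The summands in [P] are controlled in L2, the others only in L1; the free
   parameter [eta] comes from |z| <= z^2 / (2 eta) + eta / 2. *)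
Lemma mean_deviation (D U : finType) (P : pred D) (h : D -> U -> R) (eta : R) :
  (0 < #|U|)%N -> 0 < eta -> (forall d u, 0 <= h d u) ->
  mean (fun w : {ffun D -> U} => `|\sum_d h d (w d) - \sum_d mean (h d)|) <=
  (\sum_(d | P d) mean (fun u => h d u ^+ 2)) / (2 * eta) + eta / 2
    + 2 * \sum_(d | ~~ P d) mean (h d).
Proof.
move=> U0 eta0 h0.
pose A (w : {ffun D -> U}) := \sum_(d | P d) (h d (w d) - mean (h d)).
have bound (w : {ffun D -> U}) : `|\sum_d h d (w d) - \sum_d mean (h d)| <=
    (2 * eta)^-1 * A w ^+ 2 + (eta / 2 +
     \sum_(d | ~~ P d) (h d (w d) + mean (h d))).
  have -> : \sum_d h d (w d) - \sum_d mean (h d) =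
      A w + \sum_(d | ~~ P d) (h d (w d) - mean (h d)).
    by rewrite -sumrB (bigID P).
  rewrite addrA (le_trans (ler_normD _ _))// lerD//.
    rewrite -subr_ge0.
    have -> : (2 * eta)^-1 * A w ^+ 2 + eta / 2 - `|A w| =
        (2 * eta)^-1 * (`|A w| - eta) ^+ 2.
      rewrite -(real_normK (num_real (A w))); field.
      by rewrite gt_eqF.
    by rewrite mulr_ge0 ?sqr_ge0// invr_ge0 mulr_ge0// ltW.
  apply: le_trans (ler_norm_sum _ _ _) _; apply: ler_sum => d _.
  rewrite (le_trans (ler_normB _ _))// !ger0_norm//.
  by rewrite mulr_ge0 ?sumr_ge0 ?invr_ge0 ?ler0n.
apply: le_trans (ler_mean bound) _.
rewrite meanD meanZ meanD mean_cst ?mean_sum; last first.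
  by rewrite card_ffun expn_gt0 U0.
rewrite addrA lerD//; last first.
  rewrite mulr_sumr ler_sum// => d _.
  rewrite meanD mean_cst ?card_ffun ?expn_gt0 ?U0// mean_coord//.
  by rewrite mulr_natl mulr2n.
rewrite lerD2r mulrC ler_wpM2r// ?invr_ge0 ?mulr_ge0 ?(ltW eta0)//.
rewrite (mean_sqr_sum_centered _ (g := fun d u => h d u - mean (h d)))//.
  by apply: ler_sum => d _; exact: mean_sqr_center_le.
by move=> d; rewrite meanD mean_cst// subrr.
Qed.

Lemma markov_mean (T : finType) (f : T -> R) (c : R) : 0 < c ->
  (forall t, 0 <= f t) -> mean (fun t => (c < f t)%R%:R) <= mean f / c.
Proof.
move=> c0 f0; rewrite mulrC -meanZ; apply: ler_mean => t.
case: ltP => [/ltW cf|_]; last by rewrite mulr_ge0 ?invr_ge0 ?(ltW c0).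
by rewrite mulrC ler_pdivlMr// mul1r.
Qed.

Lemma mean_all_in (D U : finType) (B : pred U) (S : {set D}) : (0 < #|U|)%N ->
  mean (fun w : {ffun D -> U} => [forall d in S, B (w d)]%:R) =
  mean (fun u => (B u)%:R) ^+ #|S|.
Proof.
move=> U0.
transitivity (\prod_d mean (fun u => if d \in S then (B u)%:R else 1)).
  rewrite -mean_prod; apply: eq_mean => w.
  rewrite -big_mkcond/= -natr_prod; congr _%:R.
  apply/esym; case: forallP => [H|/forallP].
    by rewrite big1// => d dS; have := H d; rewrite dS => /= ->.
  rewrite negb_forall => /existsP[d]; rewrite negb_imply => /andP[dS nB].
  by rewrite (bigD1 d)//= (negPf nB) mul0n.
rewrite (bigID (mem S))/= [X in _ * X]big1 ?mulr1; last first.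
  by move=> d /negPf->; rewrite mean_cst.
rewrite (eq_bigr (fun=> mean (fun u => (B u)%:R))) ?prodr_const//.
by move=> d ->.
Qed.

(* A union bound over the 2^(2l) possible sets of bad coordinates replaces
   Chernoff's inequality. *)
Lemma mean_majority_bad (U : finType) (B : pred U) (l : nat) : (0 < #|U|)%N ->
  mean (fun u => (B u)%:R) <= 16^-1 ->
  mean (fun w : {ffun 'I_(l.*2) -> U} => (l <= #|[set d | B (w d)]|)%N%:R)
    <= 4^-1 ^+ l.
Proof.
move=> U0 B16.
pose P := [pred S : {set 'I_(l.*2)} | (l <= #|S|)%N].
have step (w : {ffun 'I_(l.*2) -> U}) : (l <= #|[set d | B (w d)]|)%N%:R <=
    \sum_(S | P S) [forall d in S, B (w d)]%:R :> R.
  case: leqP => [lB|_]; last by rewrite sumr_ge0.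
  rewrite (bigD1 [set d | B (w d)])//=.
  have -> : [forall d in [set d | B (w d)], B (w d)].
    by apply/forall_inP => d; rewrite inE.
  by rewrite lerDl sumr_ge0.
apply: le_trans (ler_mean step) _.
have B0 : 0 <= mean (fun u => (B u)%:R : R).
  by rewrite divr_ge0 ?sumr_ge0.
rewrite mean_sum; apply: le_trans (_ : \sum_(S | P S) 16^-1 ^+ l <= _).
  apply: ler_sum => S lS; rewrite mean_all_in//.
  apply: le_trans (_ : 16^-1 ^+ #|S| <= _).
    by rewrite lerXn2r// nnegrE invr_ge0.
  by apply: ler_wiXn2l => //; rewrite ?invr_ge0// invf_le1// ler1n.
rewrite sumr_const -(mulr_natr (_ ^+ _)).
apply: le_trans (_ : 16^-1 ^+ l * (2 ^ l.*2)%:R <= _).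
  rewrite ler_wpM2l ?exprn_ge0 ?invr_ge0// ler_nat.
  apply: leq_trans (max_card _) _.
  by rewrite -cardsT -powersetT card_powerset cardsT card_ord.
(* There are at most [4^l] sets of size at least [l], each entirely bad with probability at most
   [16^-l]. *)
rewrite -muln2 mulnC expnM natrX -exprMn (_ : 16^-1 * _ = 4^-1 :> R)//.
by rewrite (_ : (2 ^ 2)%:R = 4 :> R)//; field.
Qed.

End Mean.

(** * Protocols from finite message types *)

(** Since all code words have length [B], the cost of a protocol using them depends neither on the
    input nor on the coins. Words outside the image decode to [a0]. *)
Lemma fixed_length_code (A : finType) (B : nat) (a0 : A) : (#|A| <= 2 ^ B)%N ->
  exists (enc : A -> bits) (dec : bits -> A),
    cancel enc dec /\ forall a, size (enc a) = B.
Proof.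
move=> AB; have AB' : (#|A| <= #|{: B.-tuple bool}|)%N by rewrite card_tuple card_bool.
pose e (a : A) : B.-tuple bool := enum_val (widen_ord AB' (enum_rank a)).
have e_inj : injective e.
  by move=> a b /enum_val_inj/(congr1 val)/= /val_inj/enum_rank_inj.
exists (fun a => val (e a)), (fun s => odflt a0 [pick a | val (e a) == s]); split.
  move=> a; case: pickP => [b /eqP/val_inj/e_inj //|/(_ a)].
  by rewrite eqxx.
by move=> a; rewrite size_tuple.
Qed.

Lemma eq_card_bij (A B : finType) : #|A| = #|B| -> exists h : A -> B, bijective h.
Proof.
move=> AB; exists (fun a => enum_val (cast_ord AB (enum_rank a))).
exists (fun b => enum_val (cast_ord (esym AB) (enum_rank b))) => c;
  by rewrite enum_valK ?cast_ordK ?cast_ordKV enum_rankK.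
Qed.

Section Protocols.
Variables (R : realType) (k : nat) (I O : Type).

(** Transfers the analysis from random values in [V] to coins: [h] preserves the uniform law at
    every site, and the coordinator's own coins are averaged out. *)
Lemma mean_le_coin_prob (P : protocol k I O) (V : finType)
    (h : (ncoins P).-tuple bool -> V) (good : pred {ffun 'I_k -> V})
    (E : coins P -> Prop) : bijective h ->
  (forall w : coins P, good [ffun i => h (w.2 i)] -> E w) ->
  mean (fun w => (good w)%:R : R) <= coin_prob R E.
Proof.
move=> hbij goodE; have [g hg gh] := hbij.
have -> : coin_prob R E = mean (fun w : coins P => (`[< E w >])%:R).
  rewrite /coin_prob /mean; congr (_ / _).
  rewrite -natr_sum -sum1_card big_mkcond; congr _%:R.
  by apply: eq_bigr => w _; rewrite inE; case: asboolP.
pose h' (c : {ffun 'I_k -> (ncoins P).-tuple bool}) := [ffun i => h (c i)].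
have h'bij : bijective h'.
  exists (fun c : {ffun 'I_k -> V} => [ffun i => g (c i)]) => c; apply/ffunP => i;
  by rewrite !ffunE ?hg ?gh.
rewrite -(mean_reindex _ h'bij) -(mean_snd (S := (ncoins P).-tuple bool)); last first.
  by rewrite card_tuple card_bool expn_gt0.
apply: ler_mean => w; rewrite ler_nat.
by case: (boolP (good _)) => // /goodE Ew; rewrite asboolT.
Qed.

Variables (V D : finType) (q B : nat) (d0 : D).
Variable sketch : I -> V -> D.
Hypotheses (cardV : #|V| = (2 ^ q)%N) (cardD : (#|D| <= 2 ^ B)%N).

Let coins_bij : exists h : q.-tuple bool -> V, bijective h.
Proof. by apply: eq_card_bij; rewrite card_tuple card_bool. Qed.

(** Hides the bits: from here on a protocol consists of a random [sketch] per site and a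
    deterministic decoder [out], and success is bounded below by an event [good] on the randomness
    of the sites. *)
Lemma one_round_protocol (out : ('I_k -> D) -> O) :
  exists P : protocol k I O,
    (forall x w, communication 1 (P := P) x w = (k * B)%N) /\
    forall x (E : O -> Prop) (good : pred {ffun 'I_k -> V}),
      (forall c, good c -> E (out (fun i => sketch (x i) (c i)))) ->
      mean (fun c => (good c)%:R : R) <=
        coin_prob R (fun w : coins P => E (run 1 x w)).
Proof.
have [h hbij] := coins_bij.
have [enc [dec [encK size_enc]]] := fixed_length_code d0 cardD.
pose P := Protocol (ncoins := q) (fun _ x c _ => enc (sketch x (h c)))
  (fun _ _ _ => [::])
  (fun _ hist => out (fun i => dec (nth (fun=> [::]) hist 0 i))).
exists P; split.
  move=> x w; rewrite /communication /= big_seq1.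
  rewrite [X in (_ + X)%N]big1 => [|i _]; last exact: big_nil.
  rewrite addn0 (eq_bigr (fun=> B)) ?sum_nat_const ?card_ord//.
move=> x E good goodE; apply: (@mean_le_coin_prob P V h good _ hbij) => w /goodE.
by rewrite /run /=; congr (E (out _)); apply/funext => i; rewrite encK ffunE.
Qed.

Lemma two_round_protocol (L D' : finType) (l0 : L) (d0' : D') (BL B' : nat)
    (query : ('I_k -> D) -> L) (answer : I -> L -> D')
    (out : L -> ('I_k -> D') -> O) :
  (#|L| <= 2 ^ BL)%N -> (#|D'| <= 2 ^ B')%N ->
  exists P : protocol k I O,
    (forall x w, communication 2 (P := P) x w = (k * (B + B' + BL))%N) /\
    forall x (E : O -> Prop) (good : pred {ffun 'I_k -> V}),
      (forall c, good c ->
        let l := query (fun i => sketch (x i) (c i)) in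
        E (out l (fun i => answer (x i) l))) ->
      mean (fun c => (good c)%:R : R) <=
        coin_prob R (fun w : coins P => E (run 2 x w)).
Proof.
move=> cardL cardD'.
have [h hbij] := coins_bij.
have [enc [dec [encK size_enc]]] := fixed_length_code d0 cardD.
have [encL [decL [encLK size_encL]]] := fixed_length_code l0 cardL.
have [enc' [dec' [enc'K size_enc']]] := fixed_length_code d0' cardD'.
pose collect (hist : seq ('I_k -> bits)) :=
  query (fun i => dec (nth (fun=> [::]) hist 0 i)).
pose P := Protocol (ncoins := q)
  (* An empty list of received messages tells the site that it is in the first round. *)
  (fun _ x c d => if d is m :: _ then enc' (answer x (decL m))
                  else enc (sketch x (h c)))
  (fun _ hist _ => encL (collect hist))
  (fun _ hist => out (collect hist) (fun i => dec' (nth (fun=> [::]) hist 1 i))).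
exists P; split.
  move=> x w; rewrite /communication /= big_cons big_seq1.
  rewrite (eq_bigr (fun=> B)) => [|i _]; last by rewrite /= size_enc.
  rewrite [X in (_ + X + _)%N](eq_bigr (fun=> B')) => [|i _]; last first.
    by rewrite /received /= size_enc'.
  rewrite [X in (_ + _ + X)%N](eq_bigr (fun=> BL)) => [|i _]; last first.
    by rewrite /received /= big_seq1 size_encL.
  by rewrite !sum_nat_const card_ord; lia.
move=> x E good goodE; apply: (@mean_le_coin_prob P V h good _ hbij) => w /goodE /=.
rewrite /run /= /received /= {1 3}/collect /=.
have -> : (fun i => dec (enc (sketch (x i) (h (w.2 i))))) =
          (fun i => sketch (x i) ([ffun j => h (w.2 j)] i)).
  by apply/funext => i; rewrite encK ffunE.
congr (E (out _ _)); apply/funext => i; rewrite enc'K encLK; congr answer.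
Qed.

End Protocols.

(** * Power inequalities *)

Section Powers.
Variables (R : realType) (p : R).

Lemma ler_powRl (x y : R) : 0 <= p -> 0 <= x -> x <= y -> x `^ p <= y `^ p.
Proof.
by move=> p0 x0 xy; apply: ge0_ler_powR => //; rewrite nnegrE// (le_trans x0).
Qed.

Lemma ler_powR_anti (x y : R) : p <= 0 -> 0 < x -> x <= y -> y `^ p <= x `^ p.
Proof.
move=> p0 x0 xy; rewrite -[p]opprK 2!(powRN _ (- p)).
rewrite lef_pV2 ?posrE ?powR_gt0//; last exact: lt_le_trans xy.
by apply: ge0_ler_powR; rewrite ?oppr_ge0// nnegrE ltW// (lt_le_trans x0).
Qed.

(** Superadditivity, from [x_i^p = x_i * x_i^(p-1) <= x_i * s^(p-1)] with [s] the sum. It bounds the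
    total of the sites' [p]-th moments by that of [v]. *)
Lemma sum_powR_le (I : finType) (x : I -> R) : 1 <= p -> (forall i, 0 <= x i) ->
  \sum_i x i `^ p <= (\sum_i x i) `^ p.
Proof.
move=> p1 x0; have s0 : 0 <= \sum_i x i by apply: sumr_ge0.
have p0 : 0 < p by rewrite (lt_le_trans _ p1).
rewrite -(mulr_powRB1 s0 p0) mulr_suml; apply: ler_sum => i _.
rewrite -(mulr_powRB1 (x0 i) p0) ler_wpM2l// ge0_ler_powR ?subr_ge0 ?nnegrE//.
by rewrite (bigD1 i)//= lerDl sumr_ge0.
Qed.

(** With [d = eps / (2 * p) <= 1/2], the lower bound is [(1 - d)^p >= exp(-2dp) = exp(-eps) >= 1 -
    eps], the upper one [(1 + d)^p <= exp(eps/2) <= 1 / (1 - eps/2) <= 1 + eps]. *)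
Lemma powR_rel_error (eps v y : R) : 1 <= p -> 0 < eps < 1 -> 0 <= v ->
  `|y - v| <= eps / (2 * p) * v ->
  (1 - eps) * v `^ p <= y `^ p <= (1 + eps) * v `^ p.
Proof.
move=> p1 /andP[e0 e1] v0; have p0 : 0 < p by lra.
set d := eps / (2 * p); have dp : d * p = eps / 2 by rewrite /d; field; lra.
have d0 : 0 < d by rewrite /d divr_gt0// mulr_gt0.
have d2 : d <= 2^-1.
  by rewrite /d ler_pdivrMr ?mulr_gt0//; nra.
rewrite ler_distlC => /andP[yl yu].
have expNhalf : 1 - eps <= expR (- eps) by rewrite (le_trans _ (expR_ge1Dx _)).
apply/andP; split.
  apply: le_trans (_ : ((1 - d) * v) `^ p <= _); last first.
    by apply: ler_powRl; [lra|rewrite mulr_ge0//; lra|lra].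
  rewrite powRM//; last lra.
  rewrite ler_wpM2r ?powR_ge0//; apply: le_trans expNhalf _.
  have -> : - eps = - (2 * d) * p by rewrite mulNr -mulrA dp; field.
  rewrite expRM ler_powRl ?expR_ge0//; first lra.
  rewrite expRN -[leRHS]invrK lef_pV2 ?posrE ?expR_gt0 ?invr_gt0//; last lra.
  apply: le_trans (expR_ge1Dx _); rewrite -[leLHS]mul1r ler_pdivrMr; nra.
apply: le_trans (_ : ((1 + d) * v) `^ p <= _).
  by apply: ler_powRl; [lra|nra|lra].
rewrite powRM//; last lra.
rewrite ler_wpM2r ?powR_ge0//.
apply: le_trans (_ : expR (eps / 2) <= _).
  by rewrite -dp expRM ler_powRl ?expR_ge1Dx//; lra.
rewrite -[leLHS]invrK -expRN; apply: le_trans (_ : (1 - eps / 2)^-1 <= _).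
  rewrite lef_pV2 ?posrE ?expR_gt0//; last lra.
  by rewrite (le_trans _ (expR_ge1Dx _)).
by rewrite -[leLHS]mul1r ler_pdivrMr; nra.
Qed.

End Powers.

(** * Selecting heavy coordinates from approximate ones *)

Section Select.
Variables (R : realType) (p alpha : R) (n : nat).

(** Coordinates with [y j < sigma / 2] are discarded first, as their relative error may be large.
    The factor [4^-p] allows for errors up to a factor 2 on either side of the heaviness test. *)
Definition selection (sigma : R) (y : 'I_n -> R) : {set 'I_n} :=
  [set j | (sigma <= 2 * y j) &&
     (4^-1 `^ p * alpha * (\sum_(l | (sigma <= 2 * y l)) y l `^ p) < y j `^ p)].

Hypotheses (p1 : 1 <= p) (alpha0 : 0 < alpha).

Let p0 : 0 < p. Proof. exact: lt_le_trans p1. Qed.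
Let c0 : 0 < 4^-1 `^ p :> R. Proof. by rewrite powR_gt0// invr_gt0. Qed.

(** Each selected coordinate carries more than a [4^-p * alpha] share of the accepted mass [W],
    whatever [y] is. *)
Lemma card_selection (sigma : R) (y : 'I_n -> R) :
  #|selection sigma y|%:R <= 4 `^ p / alpha.
Proof.
rewrite ler_pdivlMr//; set J := selection _ _.
suff H : #|J|%:R * (4^-1 `^ p * alpha) <= 1.
  have -> : 4 `^ p = (4^-1 `^ p)^-1 :> R by rewrite -powRN -(@powR_inv1 R 4)// -powRrM mulrNN mul1r.
  by rewrite -[leRHS]mul1r ler_pdivlMr//; lra.
have [->|[j jJ]] := set_0Vmem J; first by rewrite cards0 mul0r.
set W := \sum_(l | (sigma <= 2 * y l)) y l `^ p.
have JW : #|J|%:R * (4^-1 `^ p * alpha) * W <= W.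
  rewrite -mulrA mulr_natl -sumr_const.
  apply: le_trans (_ : \sum_(j in J) y j `^ p <= _).
    by apply: ler_sum => l; rewrite inE => /andP[_ /ltW].
  rewrite /W [leRHS](bigID (mem J))/=.
  rewrite [X in X + _](eq_bigl (mem J)); last first.
    by move=> l /=; rewrite inE; case: (sigma <= _).
  by rewrite lerDl sumr_ge0// => l _; rewrite powR_ge0.
have W0 : 0 < W.
  have W0 : 0 <= W by rewrite /W sumr_ge0// => l _; rewrite powR_ge0.
  move: (jJ); rewrite inE => /andP[sj yj].
  have : y j `^ p <= W by rewrite /W (bigD1 j)//= lerDl sumr_ge0// => l _; rewrite powR_ge0.
  apply: lt_le_trans; apply: le_lt_trans yj.
  by rewrite !mulr_ge0 ?powR_ge0// ltW.
by rewrite -(ler_pM2r W0) mul1r.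
Qed.

Variables (eps sigma : R) (v y : 'I_n -> R).
Hypotheses (he : 0 < eps < 1) (sigma0 : 0 <= sigma).
Hypotheses (v0 : forall j, 0 <= v j) (y0 : forall j, 0 <= y j).
Hypothesis sigma_le : sigma `^ p <= alpha * \sum_j v j `^ p.
Hypothesis vy : forall j, `|y j - v j| <= eps / (2 * p) * (sigma / 4).

Let d : R := eps / (2 * p).
Let d0 : 0 < d. Proof. by case/andP: he => ? ?; rewrite divr_gt0// mulr_gt0. Qed.
Let d2 : d <= 2^-1.
Proof. by case/andP: he => ? ?; rewrite /d ler_pdivrMr ?mulr_gt0//; have := p1; nra. Qed.

Let large_rel_error j : sigma <= 4 * v j -> `|y j - v j| <= d * v j.
Proof. by move=> H; apply: le_trans (vy j) _; rewrite ler_pM2l//; lra. Qed.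

(** Acceptance gives [y j >= sigma / 2] and the error is at most [sigma / 8], so
    [v j >= 3 * sigma / 8]. *)
Let accepted_large j : sigma <= 2 * y j -> sigma <= 4 * v j.
Proof.
move=> H; have := vy j; rewrite ler_distl => /andP[_].
rewrite -/d => ?.
have : d * (sigma / 4) <= 2^-1 * (sigma / 4) by rewrite ler_wpM2r ?d2// divr_ge0.
by have := sigma0; lra.
Qed.

Lemma selection_rel_error j : j \in selection sigma y ->
  (1 - eps) * v j `^ p <= y j `^ p <= (1 + eps) * v j `^ p.
Proof.
rewrite inE => /andP[/accepted_large/large_rel_error H _].
exact: powR_rel_error.
Qed.

Lemma heavy_in_selection j :
  alpha * (\sum_l v l `^ p) < v j `^ p -> j \in selection sigma y.
Proof.
move=> heavy.
have sv : sigma <= v j.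
  rewrite leNgt; apply/negP => vs.
  have := ler_powRl (ltW p0) (v0 j) (ltW vs).
  by have := sigma_le; lra.
have yl : v j / 2 <= y j.
  have H : sigma <= 4 * v j by have := v0 j; lra.
  have := large_rel_error H.
  rewrite ler_distlC => /andP[? ?].
  have : d * v j <= 2^-1 * v j by rewrite ler_wpM2r ?d2.
  by lra.
have ysig : sigma <= 2 * y j by lra.
rewrite inE ysig/=.
apply: (@lt_le_trans _ _ ((v j / 2) `^ p)); last first.
  by apply: ler_powRl => //; [exact: ltW|rewrite divr_ge0].
rewrite powRM ?invr_ge0// mulrC.
(* One factor [2^-p] pays for [y j >= v j / 2], the other for [y l <= 2 * v l] on accepted [l]. *)
have -> : 4^-1 `^ p = 2^-1 `^ p * 2^-1 `^ p :> R.
  by rewrite -powRM ?invr_ge0//; congr (_ `^ p); field.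
set S := \sum_(l | _) _; set h := 2^-1 `^ p.
have -> : S * (h * h * alpha) = alpha * (h * S) * h by ring.
rewrite ltr_pM2r ?powR_gt0 ?invr_gt0//.
apply: le_lt_trans heavy; rewrite ler_pM2l// /S mulr_sumr.
rewrite [leRHS](bigID (fun l => sigma <= 2 * y l))/= -[leLHS]addr0 lerD ?sumr_ge0//.
  apply: ler_sum => l /accepted_large/large_rel_error.
  rewrite ler_distl => /andP[_ yu].
  rewrite -powRM ?invr_ge0//; apply: ler_powRl; first exact: ltW.
    by have := y0 l; lra.
  have : d * v l <= 2^-1 * v l by rewrite ler_wpM2r ?d2.
  by have := v0 l; lra.
by move=> l _; rewrite powR_ge0.
Qed.

End Select.

(** * Sampling a coordinate with fair coins *)

Section Slot.
Variable n : nat.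

(** Entry [u] of the list with [c j] copies of each [j], and [None] past its end: if the list fits
    into [U] slots, a uniform [u] below [U] hits [j] with probability [c j / U]. *)
Definition slot (c : 'I_n -> nat) (u : nat) : option 'I_n :=
  nth None (map Some (flatten [seq nseq (c j) j | j <- enum 'I_n])) u.

Lemma sum_slot (R : realType) (c : 'I_n -> nat) (U : nat) (g : option 'I_n -> R) :
  (\sum_j c j <= U)%N -> g None = 0 ->
  \sum_(u < U) g (slot c u) = \sum_j (c j)%:R * g (Some j).
Proof.
move=> cU gN; rewrite /slot; set s := flatten _.
have size_s : size (map Some s) = (\sum_j c j)%N.
  rewrite size_map size_flatten sumnE /shape 2!big_map big_enum.
  by apply: eq_bigr => j _; rewrite size_nseq.
rewrite -(big_mkord xpredT (fun u => g (nth None (map Some s) u))).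
rewrite (big_cat_nat _ cU)//= [X in _ + X]big_nat_cond [X in _ + X]big1 ?addr0.
  rewrite -size_s -(big_nth None xpredT) big_map big_flatten big_map big_enum.
  apply: eq_bigr => j _; rewrite big_nseq.
  by elim: (c j) => [|m IH]; rewrite ?mul0r//= IH -natr1 mulrDl mul1r addrC.
by move=> u /andP[/andP[su _] _]; rewrite nth_default ?size_s.
Qed.

End Slot.

(** * The linear sketch and its deviation *)

Section Weight.
Variables (R : realType) (p : R).
Hypothesis p0 : 0 < p.

(** Rounding [y^p] to an integer allows dyadic sampling probabilities, which fair coins realize
    exactly. *)
Definition weight (y : nat) : nat := Num.truncn (y%:R `^ p : R).

Lemma weight_le y : (weight y)%:R <= y%:R `^ p :> R.
Proof. by rewrite truncn_le powR_ge0. Qed.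

Lemma weight0 : weight 0 = 0%N.
Proof. by rewrite /weight powR0 ?truncn0// gt_eqF. Qed.

Lemma le_weight y z : (y <= z)%N -> (weight y <= weight z)%N.
Proof.
by move=> yz; apply: le_truncn; apply: ler_powRl; rewrite ?ler0n ?ler_nat// ltW.
Qed.

Lemma weight_gt0 y : (0 < weight y)%N = (0 < y)%N.
Proof.
case: y => [|y]; first by rewrite weight0.
rewrite truncn_gt0; apply: le_trans (_ : 1 `^ p <= _); first by rewrite powR1.
by apply: ler_powRl; rewrite ?ler01 ?ler1n// ltW.
Qed.

(** For [y > 0] the weight [w] is at least 1, so [y^p < w + 1 <= 2w]. *)
Lemma powR_le_weight y : y%:R `^ p <= 2 * (weight y)%:R :> R.
Proof.
case: y => [|y]; first by rewrite powR0 ?gt_eqF// weight0 mulr0.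
have := truncnS_gt (y.+1%:R `^ p : R); rewrite -/(weight _) -natr1.
have : 1 <= (weight y.+1)%:R :> R by rewrite ler1n weight_gt0.
by move=> ? /ltW ?; lra.
Qed.

Variables (n M N : nat).

Definition load (x : 'rV[nat]_n) : nat := (\sum_j weight (x ord0 j))%N.

(** The largest factor by which the weights can be scaled so that their copies fit into [2 ^ N]
    slots; it is 0 when the load is 0. *)
Definition multiplier (x : 'rV[nat]_n) : nat := (2 ^ N %/ load x)%N.

Definition draw (x : 'rV[nat]_n) (u : nat) : option ('I_n * 'I_M.+1) :=
  omap (fun j => (j, inord (x ord0 j)))
    (slot (fun j => weight (x ord0 j) * multiplier x)%N u).

(** Importance weighting: a draw returns [j] with probability [weight y * m / 2^N], and the value
    [y] is divided by it. Only transmitted data enter. *)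
Definition contribution (m : nat) (j : 'I_n) (o : option ('I_n * 'I_M.+1)) : R :=
  if o is Some (j', y) then
    if j' == j then y%:R * (2 ^ N)%:R / (weight y * m)%:R else 0
  else 0.

Lemma contribution_ge0 m j o : 0 <= contribution m j o.
Proof.
by case: o => [[j' y]|]//=; case: ifP => // _; rewrite divr_ge0 ?mulr_ge0.
Qed.

Section Site.
Variable x : 'rV[nat]_n.
Hypothesis xM : forall j, (x ord0 j <= M)%N.
Hypothesis loadN : (load x <= 2 ^ N)%N.

Let ghat : R := (2 ^ N)%:R / (multiplier x)%:R.

(** For a positive load the quotient defining the multiplier is at least 1, so its rounding loses at
    most a factor 2. For load 0 all three terms are 0. *)
Lemma load_le_ghat : (load x)%:R <= ghat <= 2 * (load x)%:R.
Proof.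
rewrite /ghat /multiplier; case: (posnP (load x)) => [->|l0].
  by rewrite divn0 invr0 mulr0 mulr0 lexx.
have m0 : (0 < 2 ^ N %/ load x)%N by rewrite divn_gt0.
rewrite ler_pdivlMr ?ltr0n// ler_pdivrMr ?ltr0n// -!natrM !ler_nat.
by rewrite mulnC leq_trunc_div/= -mulnA; have := ltn_ceil (2 ^ N) l0; nia.
Qed.

Let slotsN : (\sum_j weight (x ord0 j) * multiplier x <= 2 ^ N)%N.
Proof.
have <- : (load x * multiplier x)%N = (\sum_j weight (x ord0 j) * multiplier x)%N.
  by rewrite /load big_distrl.
by rewrite mulnC leq_trunc_div.
Qed.

Let multiplier_gt0 j : (0 < x ord0 j)%N -> (0 < multiplier x)%N.
Proof.
rewrite -weight_gt0 => w0; rewrite divn_gt0//.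
by rewrite /load (bigD1 j)//= ltn_addr.
Qed.

Let U : finType := 'I_(2 ^ N).

Let mean_draw (F : R -> R) (j : 'I_n) : F 0 = 0 ->
  mean (fun u : U => F (contribution (multiplier x) j (draw x u))) =
  (weight (x ord0 j) * multiplier x)%:R *
  F ((x ord0 j)%:R * (2 ^ N)%:R / (weight (x ord0 j) * multiplier x)%:R) / (2 ^ N)%:R.
Proof.
move=> F0; rewrite /mean card_ord; congr (_ / _).
pose g o := F (contribution (multiplier x) j
  (omap (fun j => (j, (inord (x ord0 j) : 'I_M.+1))) o)).
rewrite (sum_slot (g := g) slotsN)//.
rewrite (bigD1 j)//= big1 ?addr0 => [|j' jj'].
  by rewrite /g/= eqxx inordK// ltnS.
by rewrite /g /= (negPf jj') F0 mulr0.
Qed.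

Lemma mean_contribution (j : 'I_n) :
  mean (fun u : U => contribution (multiplier x) j (draw x u)) = (x ord0 j)%:R.
Proof.
rewrite (mean_draw (F := id))//.
case: (posnP (x ord0 j)) => [->|x0]; first by rewrite !mul0r mulr0 mul0r.
have m0 := multiplier_gt0 x0; move: (x0); rewrite -weight_gt0 => w0.
have wm0 : (weight (x ord0 j) * multiplier x)%:R != 0 :> R.
  by rewrite pnatr_eq0 -lt0n muln_gt0 w0.
have N0 : (2 ^ N)%:R != 0 :> R by rewrite pnatr_eq0 -lt0n expn_gt0.
move: wm0 N0; move: (_ * multiplier x)%:R (2 ^ N)%:R => W P W0 P0.
by field; rewrite P0.
Qed.

(** The second moment is [X^2 / W * ghat] with [W >= X^p / 2], thus at most [2 * X^(2-p) * ghat];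
    the exponent is nonpositive, so the cut-off [s] is the worst case. *)
Lemma mean_sqr_contribution (j : 'I_n) (s : R) : 2 <= p ->
  0 < s < (x ord0 j)%:R ->
  mean (fun u : U => contribution (multiplier x) j (draw x u) ^+ 2) <=
  2 * s `^ (2 - p) * ghat.
Proof.
move=> p2 /andP[s0 sx]; have x0 := lt_trans s0 sx.
have x0' : (0 < x ord0 j)%N by rewrite -(ltr0n R).
have m0 := multiplier_gt0 x0'; move: (x0'); rewrite -weight_gt0 => w0.
rewrite (mean_draw (F := fun z => z ^+ 2)) ?expr0n//.
set X : R := (x ord0 j)%:R; set W : R := (weight (x ord0 j))%:R.
have W0 : 0 < W by rewrite ltr0n.
have g0 : 0 < ghat by rewrite divr_gt0 ?ltr0n ?expn_gt0.
have -> : (weight (x ord0 j) * multiplier x)%:R *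
    (X * (2 ^ N)%:R / (weight (x ord0 j) * multiplier x)%:R) ^+ 2 / (2 ^ N)%:R =
    X ^+ 2 / W * ghat.
  rewrite /ghat /W; rewrite natrM; move: (W0) (m0); rewrite /W -(ltr0n R) => /lt0r_neq0 ? /lt0r_neq0 ?.
  have : (2 ^ N)%:R != 0 :> R by rewrite pnatr_eq0 -lt0n expn_gt0.
  move: (2 ^ N)%:R => P P0; field; apply/and3P; split => //.
rewrite ler_pM2r//.
apply: le_trans (_ : 2 * X `^ (2 - p) <= _); last first.
  by rewrite ler_pM2l//; apply: ler_powR_anti; rewrite ?subr_le0// ltW.
rewrite powRB; last by apply/implyP => _; rewrite gt_eqF.
rewrite powR_mulrn ?(ltW x0)// mulrCA ler_pM2l ?exprn_gt0//.
rewrite -[leLHS]mul1r ler_pdivrMr// mulrAC ler_pdivlMr ?powR_gt0// mul1r.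
exact: powR_le_weight.
Qed.

End Site.
End Weight.

(** * The sketch and the vectors consistent with it *)

Section Sketch.
Variables (R : realType) (p alpha eps : R) (k n M N l T : nat) (j0 : 'I_n).

Definition site_coins : finType := {ffun 'I_l.*2 * 'I_T -> 'I_(2 ^ N)}.

(* The multiplier of the site, its exact entry at [j0], and its draws. *)
Definition digest : finType :=
  ('I_(2 ^ N).+1 * 'I_M.+1 *
   {ffun 'I_l.*2 * 'I_T -> option ('I_n * 'I_M.+1)})%type.

Definition sketch (x : 'rV[nat]_n) (c : site_coins) : digest :=
  (inord (multiplier p N x), inord (x ord0 j0),
   [ffun r => draw p M N x (c r)]).

Definition estimate (d : 'I_k -> digest) (r : 'I_l.*2) (j : 'I_n) : R :=
  \sum_(it : 'I_k * 'I_T)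
    contribution p N (d it.1).1.1 j ((d it.1).2 (r, it.2)) / T%:R.

Definition mass (d : 'I_k -> digest) : R :=
  \sum_i (2 ^ N)%:R / (d i).1.1%:R.

(* Every [j] with [v_j^p > alpha * ||v||_p^p] satisfies [v_j >= scale]. *)
Definition scale (d : 'I_k -> digest) : R := (alpha * mass d / 2) `^ p^-1.

Definition radius (d : 'I_k -> digest) : R := eps * scale d / (16 * p).

(** Decoding by search: an integer vector that agrees with a strict majority of the [2l] estimates
    at every coordinate can replace [v]. Exactness at [j0] makes that coordinate safe as padding of
    the cover. *)
Definition consistent (d : 'I_k -> digest) (y : 'I_n -> nat) : bool :=
  (y j0 == \sum_i (d i).1.2)%N &&
  [forall j, (l < #|[set r | (`|estimate d r j - (y j)%:R| <= radius d)%R]|)%N].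

(** Two strict majorities of the [2l] repetitions share some [r], whose estimate is within the
    radius of both values. *)
Lemma consistent_close (d : 'I_k -> digest) (y z : 'I_n -> nat) :
  consistent d y -> consistent d z ->
  forall j, `|(y j)%:R - (z j)%:R| <= 2 * radius d.
Proof.
move=> /andP[_ /forallP yd] /andP[_ /forallP zd] j.
have := yd j; have := zd j; set A := [set r | _]; set B := [set r | _] => lA lB.
have [AB0|[r]] := set_0Vmem (A :&: B).
  have := cardsUI A B; rewrite AB0 cards0 addn0 => cAB.
  have := max_card (A :|: B); rewrite card_ord cAB.
  by lia.
rewrite !inE => /andP[zr yr].
have -> : (y j)%:R - (z j)%:R =
    (estimate d r j - (z j)%:R) - (estimate d r j - (y j)%:R) by ring.
by rewrite (le_trans (ler_normB _ _))//; lra.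
Qed.

Hypotheses (hp : 2 <= p) (alpha0 : 0 < alpha) (eps01 : 0 < eps < 1) (k0 : (0 < k)%N).
Hypothesis T0 : (0 < T)%N.
Hypothesis largeT :
  (2048 * p) `^ p * k%:R `^ (p - 2) <= T%:R * (alpha * eps `^ p).
Hypothesis largeN : (n * weight p M <= 2 ^ N)%N.
Hypothesis large_l : (n <= 2 ^ l)%N.

Let p0 : 0 < p. Proof. exact: lt_le_trans hp. Qed.
Let p1 : 1 <= p. Proof. by rewrite (le_trans _ hp)// ler1n. Qed.

(** * Deviation of the estimates on a fixed input *)

Section Deviation.
Variable x : 'I_k -> 'rV[nat]_n.
Hypothesis xM : forall i j, (x i ord0 j <= M)%N.

Let loadN i : (load p (x i) <= 2 ^ N)%N.
Proof.
apply: leq_trans largeN; rewrite -[X in (_ <= X * _)%N]card_ord -sum_nat_const.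
by apply: leq_sum => j _; apply: le_weight.
Qed.

Let U : finType := 'I_(2 ^ N).
Let U0 : (0 < #|U|)%N. Proof. by rewrite card_ord expn_gt0. Qed.

Let ghat i : R := (2 ^ N)%:R / (multiplier p N (x i))%:R.
Let G := \sum_i ghat i.
Let sigma := (alpha * G / 2) `^ p^-1.
Let eta := eps * sigma / (16 * p).
Let v j : nat := Defs.total x ord0 j.

Let ghat_ge0 i : 0 <= ghat i. Proof. by rewrite divr_ge0. Qed.
Let G_ge0 : 0 <= G. Proof. by rewrite sumr_ge0. Qed.

Let vE j : v j = (\sum_i x i ord0 j)%N. Proof. by rewrite /v /Defs.total summxE. Qed.

(** Here [sigma^p = alpha * G / 2], where [G] is at most twice the total load, and the total load is
    at most [sum_ij x_ij^p <= sum_j v_j^p]. *)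
Lemma scale_powR : sigma `^ p <= alpha * \sum_j (v j)%:R `^ p.
Proof.
rewrite -powRrM mulVf ?gt_eqF// powRr1; last first.
  by rewrite divr_ge0// mulr_ge0// ltW.
rewrite -mulrA ler_pM2l// ler_pdivrMr// mulr_suml.
apply: le_trans (_ : \sum_i 2 * (load p (x i))%:R <= _).
  by apply: ler_sum => i _; have /andP[] := load_le_ghat p0 (loadN i).
rewrite -mulr_sumr -mulr_suml mulrC ler_pM2r//.
apply: le_trans (_ : \sum_i \sum_j (x i ord0 j)%:R `^ p <= _).
  by apply: ler_sum => i _; rewrite natr_sum ler_sum// => j _; apply: weight_le.
rewrite exchange_big; apply: ler_sum => j _ /=.
rewrite vE natr_sum; apply: sum_powR_le => // i; exact: ler0n.
Qed.

Let h (j : 'I_n) (it : 'I_k * 'I_T) (u : U) : R :=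
  contribution p N (multiplier p N (x it.1)) j (draw p M N (x it.1) u) / T%:R.

Let mean_h j it : mean (h j it) = (x it.1 ord0 j)%:R / T%:R.
Proof.
rewrite -(mean_contribution p0 (xM it.1) (loadN it.1)) mulrC -meanZ.
by apply: eq_mean => u; rewrite /h mulrC.
Qed.

Let sum_mean_h j : \sum_it mean (h j it) = (v j)%:R.
Proof.
rewrite vE natr_sum -(pair_bigA _ (fun i t => mean (h j (i, t))))/=.
apply: eq_bigr => i _; rewrite (eq_bigr _ (fun t _ => mean_h j (i, t)))/=.
by rewrite sumr_const card_ord -(mulr_natr (_ / _)) divfK// pnatr_eq0 -lt0n.
Qed.

Lemma mean_estimate_error j : 0 < G ->
  mean (fun w : {ffun 'I_k * 'I_T -> U} =>
    `|\sum_it h j it (w it) - (v j)%:R|) <= eta / 16.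
Proof.
move=> G0; have /andP[e0 e1] := eps01.
have sigma0 : 0 < sigma by rewrite powR_gt0 ?divr_gt0 ?mulr_gt0.
have eta0 : 0 < eta by rewrite divr_gt0 ?mulr_gt0.
have k0' : 0 < k%:R :> R by rewrite ltr0n.
have T0' : 0 < T%:R :> R by rewrite ltr0n.
(* Chosen so that the cut-off is [s = eta / (128 * k)]: entries below it add up to at most
   [eta / 128] over the [k] sites. *)
pose rho := eps / (2048 * p * k%:R).
have rho0 : 0 < rho by rewrite divr_gt0 ?mulr_gt0.
pose s := rho * sigma; have s0 : 0 < s by rewrite mulr_gt0.
pose large := [pred it : 'I_k * 'I_T | s < (x it.1 ord0 j)%:R].
have eta32 : 0 < eta / 32 by rewrite divr_gt0.
have h0 it u : 0 <= h j it u by rewrite divr_ge0 ?contribution_ge0.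
(* With variance at most [eta^2 / 512] and small part at most [eta / 128], the three terms are at
   most [eta / 32], [eta / 64] and [eta / 64], in all [eta / 16]. *)
have := @mean_deviation R _ _ large (h j) (eta / 32) U0 eta32 h0.
rewrite sum_mean_h => /le_trans -> //.
have small : \sum_(it | ~~ large it) mean (h j it) <= eta / 128.
  apply: le_trans (_ : \sum_(it : 'I_k * 'I_T) s / T%:R <= _).
    rewrite [leRHS](bigID large)/= -[leLHS]add0r lerD ?sumr_ge0//.
      by move=> it _; rewrite divr_ge0 ?ltW.
    apply: ler_sum => it; rewrite -leNgt => xs.
    by rewrite mean_h ler_pM2r ?invr_gt0.
  rewrite sumr_const card_prod !card_ord -(mulr_natr (s / _)) natrM.
  rewrite /s /rho /eta le_eqVlt; apply/orP; left; apply/eqP; field.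
  by rewrite !gt_eqF.
have var : \sum_(it | large it) mean (fun u => h j it u ^+ 2) <=
    eta ^+ 2 / 512.
  apply: le_trans (_ : \sum_(it : 'I_k * 'I_T)
      (2 * s `^ (2 - p) / T%:R ^+ 2) * ghat it.1 <= _).
    rewrite [leRHS](bigID large)/= -[leLHS]addr0 lerD ?sumr_ge0//; last first.
      by move=> it _; rewrite mulr_ge0// divr_ge0 ?exprn_ge0 ?mulr_ge0 ?powR_ge0.
    apply: ler_sum => it xs.
    have := @mean_sqr_contribution R p p0 n M N (x it.1) (xM it.1) (loadN it.1) j s hp.
    rewrite s0 xs => /(_ isT) H.
    rewrite mulrAC ler_pdivlMr ?exprn_gt0// mulrC -meanZ.
    rewrite (eq_mean (g := fun u : U => contribution p N (multiplier p N (x it.1)) j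
       (draw p M N (x it.1) u) ^+ 2))// => u.
    by rewrite /h; field; rewrite gt_eqF.
  rewrite -(pair_bigA _ (fun i (_ : 'I_T) => 2 * s `^ (2 - p) / T%:R ^+ 2 * ghat i))/=.
  rewrite (eq_bigr (fun i => 2 * s `^ (2 - p) / T%:R * ghat i)) => [|i _]; last first.
    rewrite sumr_const card_ord -(mulr_natr (_ * ghat i)); field.
    by rewrite gt_eqF.
  rewrite -mulr_sumr -/G.
  have GE : G = 2 * sigma `^ p / alpha.
    rewrite -powRrM mulVf ?gt_eqF// powRr1 ?divr_ge0 ?mulr_ge0 ?ltW//.
    by field; rewrite gt_eqF.
  have sE : s `^ (2 - p) * sigma `^ p = rho ^+ 2 / rho `^ p * sigma ^+ 2.
    rewrite /s powRM ?ltW// -mulrA -powRD ?(gt_eqF sigma0) ?implybT// subrK.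
    rewrite powR_mulrn ?ltW//; congr (_ * _).
    by rewrite powRB ?(gt_eqF rho0) ?implybT// powR_mulrn// ltW.
  have -> : 2 * s `^ (2 - p) / T%:R * G =
      4 / (T%:R * alpha) * (s `^ (2 - p) * sigma `^ p).
    by rewrite GE; field; rewrite !gt_eqF.
  rewrite sE.
  have -> : eta ^+ 2 / 512 = 32 * k%:R ^+ 2 * rho ^+ 2 * sigma ^+ 2.
    by rewrite /eta /rho; field; rewrite !gt_eqF.
  have rp : 0 < rho `^ p by rewrite powR_gt0.
  have -> : 4 / (T%:R * alpha) * (rho ^+ 2 / rho `^ p * sigma ^+ 2) =
      4 / (T%:R * alpha * rho `^ p) * rho ^+ 2 * sigma ^+ 2.
    by field; rewrite !gt_eqF.
  rewrite !ler_pM2r ?exprn_gt0// ler_pdivrMr ?mulr_gt0//.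
  have rhopE : rho `^ p * ((2048 * p) `^ p * k%:R `^ p) = eps `^ p.
    have p0' : 0 <= 2048 * p by rewrite mulr_ge0// ltW.
    rewrite -(powRM p p0')// -(powRM p (ltW rho0)); last by rewrite mulr_ge0.
    by congr (_ `^ p); rewrite /rho; field; rewrite !gt_eqF.
  (* Of the [k^p] in [rho^-p], a factor [k^2] is absorbed by [eta^2 / rho^2]; the remaining
     [k^(p-2)] is what [largeT] provides. *)
  have kE : k%:R `^ p = k%:R `^ (p - 2) * k%:R ^+ 2 :> R.
    rewrite -powR_mulrn ?ltW// -powRD ?subrK//.
    by rewrite (gt_eqF k0') implybT.
  have : 1 <= k%:R ^+ 2 * (T%:R * alpha * rho `^ p).
    have c0 : 0 < (2048 * p) `^ p * k%:R `^ (p - 2) by rewrite mulr_gt0 ?powR_gt0 ?mulr_gt0.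
    rewrite -(ler_pM2r c0) mul1r; apply: le_trans largeT _.
    rewrite -rhopE kE le_eqVlt.
    by apply/orP; left; apply/eqP; ring.
  by lra.
have : (\sum_(it | large it) mean (fun u => h j it u ^+ 2)) / (2 * (eta / 32)) <=
    eta / 32.
  have eta16 : 0 < 2 * (eta / 32) by exact: mulr_gt0.
  rewrite ler_pdivrMr//; apply: le_trans var _.
  by rewrite le_eqVlt; apply/orP; left; apply/eqP; field.
have combine (a b e : R) : b <= e / 128 -> a <= e / 32 ->
    a + e / 32 / 2 + 2 * b <= e / 16 by lra.
exact: combine small.
Qed.

Let bad (j : 'I_n) (w : {ffun 'I_k * 'I_T -> U}) : bool :=
  eta < `|\sum_it h j it (w it) - (v j)%:R|.

(** Markov's inequality; [G = 0] is the zero input, where every estimate is exactly 0. *)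
Let mean_bad j : mean (fun w => (bad j w)%:R) <= 16^-1 :> R.
Proof.
have p16 : 0 < 16 * p by rewrite mulr_gt0.
have [e0 _] := andP eps01.
case: (eqVneq G 0) => [G_eq0|Gn0]; last first.
  have G0 : 0 < G by rewrite lt_neqAle eq_sym Gn0 G_ge0.
  have eta0 : 0 < eta by rewrite divr_gt0// mulr_gt0// powR_gt0 ?divr_gt0 ?mulr_gt0.
  apply: le_trans (markov_mean eta0 (fun w => normr_ge0 _)) _.
  by rewrite ler_pdivrMr// [leRHS]mulrC mean_estimate_error.
have ghat0 i : ghat i = 0.
  have /psumr_eq0P H : forall i, true -> 0 <= ghat i by move=> ? _; exact: ghat_ge0.
  exact: H G_eq0 i isT.
have load0 i : load p (x i) = 0%N.
  apply/eqP; rewrite -(pnatr_eq0 R) eq_le ler0n andbT -(ghat0 i).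
  by have /andP[] := load_le_ghat p0 (loadN i).
have v_eq0 : v j = 0%N.
  rewrite vE big1// => i _; apply/eqP; rewrite -leqn0 leqNgt -(weight_gt0 p0).
  rewrite -leqNgt; apply: leq_trans (_ : load p (x i) <= _)%N; last by rewrite load0.
  by rewrite /load (bigD1 j)//= leq_addr.
rewrite (eq_mean (g := fun=> 0)) ?mean_cst ?invr_ge0//.
  by rewrite card_ffun expn_gt0 U0.
move=> w; rewrite /bad v_eq0 subr0 big1 ?normr0.
  rewrite ltNge divr_ge0 ?mulr_ge0 ?powR_ge0//; exact: ltW.
move=> it _; rewrite /h /multiplier load0 divn0 /contribution.
by case: draw => [[j' y]|]; rewrite ?muln0 ?invr0 ?mulr0 ?if_same mul0r.
Qed.

(** Regroups the coins by repetition instead of by site, which exhibits the [2l] repetitions as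
    independent. *)
Let transpose (c : {ffun 'I_k -> site_coins}) :
    {ffun 'I_l.*2 -> {ffun 'I_k * 'I_T -> U}} :=
  [ffun r => [ffun it => c it.1 (r, it.2)]].

Let transpose_bij : bijective transpose.
Proof.
exists (fun w : {ffun 'I_l.*2 -> {ffun 'I_k * 'I_T -> U}} =>
  [ffun i => [ffun rt : 'I_l.*2 * 'I_T => w rt.1 (i, rt.2)] : site_coins]) => c;
  apply/ffunP => a; apply/ffunP => -[b1 b2]; by rewrite !ffunE.
Qed.

Let digests (c : {ffun 'I_k -> site_coins}) i := sketch (x i) (c i).

Let multiplierN i : (multiplier p N (x i) < (2 ^ N).+1)%N.
Proof. by rewrite ltnS leq_div. Qed.

(** The multipliers do not depend on the coins, so the coordinator's [scale] is the fixed number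
    [sigma]. *)
Let scaleE c : scale (digests c) = sigma.
Proof.
rewrite /scale /mass /digests/= /sigma /G; congr (_ `^ _); congr (_ * _ / _).
by apply: eq_bigr => i _; rewrite inordK.
Qed.

Let estimateE c r j :
  estimate (digests c) r j = \sum_it h j it (transpose c r it).
Proof.
by apply: eq_bigr => it _; rewrite /h /digests/= inordK// !ffunE.
Qed.

Lemma scale_sketch_powR (c : {ffun 'I_k -> site_coins}) :
  scale (fun i => sketch (x i) (c i)) `^ p <=
  alpha * \sum_j (Defs.total x ord0 j)%:R `^ p.
Proof. by rewrite -/(digests c) scaleE; exact: scale_powR. Qed.

(** The vector [v] fails to be consistent only if, at some [j], at least [l] of the [2l] repetitions
    are bad. A union bound gives [n * 4^-l <= 1 / n], as [n <= 2^l]. *)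
Lemma mean_consistent : (0 < n)%N ->
  1 - n%:R^-1 <= mean (fun c : {ffun 'I_k -> site_coins} =>
    (consistent (fun i => sketch (x i) (c i)) (Defs.total x ord0))%:R) :> R.
Proof.
move=> n0.
pose many_bad j (w : {ffun 'I_l.*2 -> {ffun 'I_k * 'I_T -> U}}) : R :=
  (l <= #|[set r | bad j (w r)]|)%N%:R.
have step c : 1 + - \sum_j many_bad j (transpose c) <=
    (consistent (digests c) v)%:R.
  case: (boolP (consistent _ _)) => [_|].
    by rewrite gerDl oppr_le0 sumr_ge0.
  rewrite /consistent negb_and => /orP[/negP[]|].
    by rewrite vE; apply/eqP/eq_bigr => i _; rewrite /digests/= inordK// ltnS.
  rewrite negb_forall => /existsP[j].
  rewrite -leqNgt => few; rewrite subr_le0 (bigD1 j)//= -[leLHS]addr0 lerD ?sumr_ge0//.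
  rewrite /many_bad; case: leqP => //; rewrite ltnNge => /negP[].
  have -> : [set r | bad j (transpose c r)] =
      ~: [set r | (`|estimate (digests c) r j - (v j)%:R| <= radius (digests c))%R].
    by apply/setP => r; rewrite !inE -ltNge estimateE /radius scaleE.
  rewrite -(leq_add2l l) addnn -[X in (X <= _)%N](card_ord l.*2).
  by rewrite -(cardsC [set r | (`|estimate (digests c) r j - (v j)%:R| <= radius (digests c))%R]) leq_add2r.
apply: le_trans (ler_mean step).
have V0 : (0 < #|{ffun 'I_k -> site_coins}|)%N.
  by rewrite !card_ffun !expn_gt0 card_ord expn_gt0.
rewrite meanD meanN mean_cst// lerD2l lerN2 mean_sum.
apply: le_trans (_ : \sum_(j < n) 4^-1 ^+ l <= _).
  apply: ler_sum => j _; rewrite (mean_reindex (many_bad j) transpose_bij).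
  by apply: mean_majority_bad; rewrite ?card_ffun ?expn_gt0 ?U0 ?mean_bad.
rewrite sumr_const card_ord -(mulr_natr (_ ^+ _)) exprVn mulrC.
rewrite ler_pdivrMr ?exprn_gt0// mulrC ler_pdivlMr ?ltr0n//.
rewrite -natrM -natrX ler_nat.
by rewrite (_ : 4 = 2 * 2)%N// expnMn leq_mul.
Qed.

End Deviation.
End Sketch.

(** * The two protocols *)

Section Pairs.
Variables (R : realType) (n S : nat) (e : 'I_S -> 'I_n) (w : 'I_n -> R).

Definition pairs : {fset 'I_n * R} :=
  [fset q in [seq (e s, w (e s)) | s <- enum 'I_S]]%fset.

Lemma card_pairs : (#|` pairs| <= S)%N.
Proof.
by rewrite card_fseq (leq_trans (size_undup _))// size_map size_enum_ord.
Qed.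

Lemma is_cover_pairs (alpha eps : R) (u : 'rV[R]_n) : (0 < S)%N ->
  (forall j, alpha * (\sum_l u 0 l) < u 0 j -> exists s, e s = j) ->
  (forall s, (1 - eps) * u 0 (e s) <= w (e s) <= (1 + eps) * u 0 (e s)) ->
  is_cover alpha eps u pairs.
Proof.
move=> S0 heavy close.
have mem s : (e s, w (e s)) \in pairs by rewrite inE; apply: map_f; rewrite mem_enum.
split.
- by apply/fset0Pn; exists (e (Ordinal S0), w (e (Ordinal S0))).
- by move=> j /heavy[s <-]; exists (w (e s)).
- by move=> q; rewrite inE => /mapP[s _ ->] /=.
Qed.

End Pairs.

Lemma leq_expl (a b e : nat) : (a <= b -> a ^ e <= b ^ e)%N.
Proof. by case: e => // e ab; rewrite leq_exp2r. Qed.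

(** * Decoding and correctness of both covers *)

Section Cover.
Variables (R : realType) (p : R) (k n M N l T m : nat) (j0 : 'I_n).
Variables (alpha eps : R).
Hypotheses (hp : 2 <= p) (alpha0 : 0 < alpha) (eps01 : 0 < eps < 1) (k0 : (0 < k)%N).
Hypothesis T0 : (0 < T)%N.
Hypothesis largeT :
  (2048 * p) `^ p * k%:R `^ (p - 2) <= T%:R * (alpha * eps `^ p).
Hypothesis largeN : (n * weight p M <= 2 ^ N)%N.
Hypothesis large_l : (n <= 2 ^ l)%N.
Hypothesis large_m : (M < 2 ^ m)%N.

Let p1 : 1 <= p. Proof. by rewrite (le_trans _ hp)// ler1n. Qed.
Let n0 : (0 < n)%N. Proof. exact: leq_ltn_trans (ltn_ord j0). Qed.

Notation D := (digest n M N l T).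

(** [N + 1] bits encode the multiplier, [m] the entry at [j0], and [l + m + 1] each draw, the extra
    bit making room for [None]. *)
Definition digest_bits : nat := (N.+1 + m + (l + m).+1 * (l.*2 * T))%N.

Lemma card_digest : (#|D| <= 2 ^ digest_bits)%N.
Proof.
rewrite /digest_bits !card_prod card_ffun card_option !card_prod !card_ord.
rewrite (expnD _ (_ + _)) (expnD _ _ m) (expnM _ (l + m).+1); apply: leq_mul; first apply: leq_mul => //.
  by rewrite expnS mul2n -addnn -addn1 leq_add2l expn_gt0.
apply: leq_expl.
rewrite expnS expnD; have := leq_mul large_l large_m.
by have := expn_gt0 2 l; have := expn_gt0 2 m; nia.
Qed.

Lemma card_site_coins : #|site_coins N l T| = (2 ^ (N * (l.*2 * T)))%N.
Proof. by rewrite card_ffun card_prod !card_ord -expnM. Qed.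

(** The coordinator is not bounded computationally, so it may choose any consistent vector; the
    default 0 stands for the case that there is none. *)
Definition decode (d : 'I_k -> D) : 'I_n -> nat :=
  if pselect (exists y, consistent p alpha eps j0 d y) is left ex
  then projT1 (cid ex) else fun=> 0%N.

Definition heavy_set (d : 'I_k -> D) : {set 'I_n} :=
  selection p alpha (scale p alpha d) (fun j => (decode d j)%:R).

Definition cover_size : nat := (Num.truncn (4 `^ p / alpha : R)).+1.

(* Since [cover_size] exceeds [#|heavy_set d|], the list ends with [j0]; this
   makes the cover nonempty. *)
Definition candidate (d : 'I_k -> D) (s : 'I_cover_size) : 'I_n :=
  nth j0 (enum (heavy_set d)) s.

Lemma candidate_in (d : 'I_k -> D) s :
  candidate d s = j0 \/ candidate d s \in heavy_set d.
Proof.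
rewrite /candidate; case: (ltnP s (size (enum (heavy_set d)))) => [H|H].
  by right; rewrite -mem_enum mem_nth.
by left; rewrite nth_default.
Qed.

Lemma candidate_onto (d : 'I_k -> D) j : j \in heavy_set d ->
  exists s, candidate d s = j.
Proof.
move=> jH; have jE : j \in enum (heavy_set d) by rewrite mem_enum.
have iS : (index j (enum (heavy_set d)) < cover_size)%N.
  apply: leq_trans (_ : #|heavy_set d| < _)%N; first by rewrite ltnS cardE ltnW// index_mem.
  rewrite ltnS truncn_ge_nat; first exact: card_selection.
  by rewrite divr_ge0 ?powR_ge0// ltW.
by exists (Ordinal iS); rewrite /candidate nth_index.
Qed.

Lemma decode_consistent (d : 'I_k -> D) (y : 'I_n -> nat) :
  consistent p alpha eps j0 d y -> consistent p alpha eps j0 d (decode d).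
Proof.
rewrite /decode; case: pselect => [ex _|nex yd]; first exact: (projT2 (cid ex)).
by case: nex; exists y.
Qed.

Section Input.
Variable x : 'I_k -> 'rV[nat]_n.
Hypothesis xM : forall i j, (x i ord0 j <= M)%N.
Variable c : {ffun 'I_k -> site_coins N l T}.
Let d i : D := sketch p M j0 (x i) (c i).
Let v : 'I_n -> nat := Defs.total x ord0.
Hypothesis vd : consistent p alpha eps j0 d v.

(** Both vectors are consistent, and [2 * radius] is exactly this bound; hence the constant 16 in
    [radius]. *)
Let close j : `|(decode d j)%:R - (v j)%:R| <=
  eps / (2 * p) * (scale p alpha d / 4) :> R.
Proof.
have := consistent_close (decode_consistent vd) vd j => /le_trans; apply.
rewrite /radius le_eqVlt; apply/orP; left; apply/eqP; field.
by rewrite gt_eqF// (lt_le_trans _ p1).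
Qed.

Let sigma_le : scale p alpha d `^ p <= alpha * \sum_j (v j)%:R `^ p.
Proof. exact: (scale_sketch_powR j0 hp alpha0 largeN xM c). Qed.

Lemma candidate_heavy j :
  alpha * (\sum_l vpow (Defs.total x) p 0 l) < vpow (Defs.total x) p 0 j ->
  exists s, candidate d s = j.
Proof.
rewrite mxE (eq_bigr (fun l => (v l)%:R `^ p)) => [|? _]; last by rewrite mxE.
move=> heavy; apply: candidate_onto.
apply: (heavy_in_selection p1 alpha0 eps01 _ _ _ sigma_le close heavy) => //.
exact: powR_ge0.
Qed.

Lemma candidate_rel_error s :
  (1 - eps) * vpow (Defs.total x) p 0 (candidate d s) <=
  (decode d (candidate d s))%:R `^ p <=
  (1 + eps) * vpow (Defs.total x) p 0 (candidate d s).
Proof.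
rewrite mxE; case: (candidate_in d s) => [->|H]; last first.
  apply: (selection_rel_error p1 eps01 _ _ close H) => //.
  exact: powR_ge0.
(* Padding slot: both vectors take the transmitted exact value at [j0]. *)
have [/andP[/eqP-> _] /andP[/eqP vj0 _]] := (decode_consistent vd, vd).
rewrite -vj0 -/v; have /andP[e0 e1] := eps01.
by have := powR_ge0 (v j0)%:R p; nra.
Qed.

End Input.

Let default_digest : D := (ord0, ord0, [ffun=> None]).

Let coin_prob_bound (x : 'I_k -> 'rV[nat]_n) (a : R)
    (xM : forall i j, (x i ord0 j <= M)%N) :
  mean (fun c : {ffun 'I_k -> site_coins N l T} =>
    (consistent p alpha eps j0 (fun i => sketch p M j0 (x i) (c i) : D)
      (Defs.total x ord0))%:R) <= a -> 1 - n%:R^-1 <= a.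
Proof.
apply: le_trans.
exact: (mean_consistent j0 hp alpha0 eps01 k0 T0 largeT largeN large_l xM n0).
Qed.

Lemma one_round_cover : exists P : protocol k 'rV[nat]_n {fset 'I_n * R},
  computes_cover 1 p M alpha eps cover_size%:R (k * digest_bits)%:R P.
Proof.
have [P [commP probP]] := one_round_protocol R default_digest (sketch p M j0)
  card_site_coins card_digest
  (fun d : 'I_k -> D => pairs (candidate d) (fun j => (decode d j)%:R `^ p)).
exists P => x xM; split; first by move=> w; rewrite commP.
apply: (coin_prob_bound xM).
apply: (probP x
  (fun Q => is_cover alpha eps (vpow (Defs.total x) p) Q /\ #|` Q|%:R <= cover_size%:R)).
move=> c vd; split; last by rewrite ler_nat card_pairs.
apply: is_cover_pairs => //.
  exact: (candidate_heavy xM vd).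
exact: (candidate_rel_error vd).
Qed.

(* The approximate values of the first round only serve to select candidates, so
   any fixed accuracy [eps] will do. *)
Lemma two_round_cover : exists P : protocol k 'rV[nat]_n {fset 'I_n * R},
  computes_cover 2 p M alpha 0 cover_size%:R
    (k * (digest_bits + m * cover_size + l * cover_size))%:R P.
Proof.
have cardL : (#|{: {ffun 'I_cover_size -> 'I_n}}| <= 2 ^ (l * cover_size))%N.
  by rewrite card_ffun !card_ord expnM leq_expl.
have cardA : (#|{: {ffun 'I_cover_size -> 'I_M.+1}}| <= 2 ^ (m * cover_size))%N.
  by rewrite card_ffun !card_ord expnM leq_expl.
have [P [commP probP]] := two_round_protocol R default_digest (sketch p M j0)
  card_site_coins card_digest [ffun=> j0] [ffun=> ord0]
  (fun d : 'I_k -> D => finfun (candidate d))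
  (fun (x : 'rV[nat]_n) (e : {ffun 'I_cover_size -> 'I_n}) =>
     [ffun s => inord (x ord0 (e s)) : 'I_M.+1])
  (fun e (r : 'I_k -> {ffun 'I_cover_size -> 'I_M.+1}) =>
     pairs e (fun j => (\sum_i oapp (fun s => r i s : nat) 0%N [pick s | e s == j])%N%:R `^ p))
  cardL cardA.
exists P => x xM; split; first by move=> w; rewrite commP.
apply: (coin_prob_bound xM).
apply: (probP x
  (fun Q => is_cover alpha 0 (vpow (Defs.total x) p) Q /\ #|` Q|%:R <= cover_size%:R)).
move=> c vd /=; set d := fun i => sketch _ _ _ _ _.
split; last by rewrite ler_nat card_pairs.
apply: is_cover_pairs => //.
  move=> j /(candidate_heavy xM vd)[s <-]; exists s; by rewrite ffunE.
move=> s; rewrite subr0 addr0 mul1r mxE /Defs.total summxE.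
(* The picked slot [s'] may differ from [s] when a candidate is repeated, but both hold the same
   coordinate. *)
case: pickP => [s' /eqP es|/(_ s)]; last by rewrite eqxx.
rewrite (eq_bigr (fun i => x i ord0 (finfun (candidate d) s))) ?lexx// => i _ /=.
by rewrite ffunE inordK ?ltnS// es.
Qed.

End Cover.

(** * Choice of the sizes *)

Lemma computes_cover_mono (R : realType) (k n r : nat) (p : R) (M : nat)
    (alpha eps S S' B B' : R) (P : protocol k 'rV[nat]_n {fset 'I_n * R}) :
  S <= S' -> B <= B' -> computes_cover r p M alpha eps S B P ->
  computes_cover r p M alpha eps S' B' P.
Proof.
move=> SS' BB' H x xM; have [comm prob] := H x xM.
split=> [w|]; first exact: le_trans (comm w) BB'.
apply: le_trans prob _; rewrite ler_wpM2r ?invr_ge0// ler_nat.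
apply/subset_leq_card/subsetP => w; rewrite !inE => /asboolP[cov size].
by apply/asboolP; split=> //; exact: le_trans size SS'.
Qed.

(* For [n = 1] the required success probability is 0, and so is the budget. *)
Lemma silent_cover (R : realType) (k : nat) (p : R) (M : nat) (alpha eps S : R) :
  0 <= S ->
  (exists P : protocol k 'rV[nat]_1 {fset 'I_1 * R},
    computes_cover 1 p M alpha eps S 0 P) /\
  (exists P : protocol k 'rV[nat]_1 {fset 'I_1 * R},
    computes_cover 2 p M alpha eps S 0 P).
Proof.
have card1 : #|{: unit}| = (2 ^ 0)%N by rewrite card_unit.
have card1' : (#|{: unit}| <= 2 ^ 0)%N by rewrite card_unit.
move=> S0; split.
  have [P [commP _]] := one_round_protocol (I := 'rV[nat]_1) (k := k) R tt
    (fun _ (_ : unit) => tt) card1 card1' (fun=> fset0 : {fset 'I_1 * R}).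
  exists P => x _; split; first by move=> w; rewrite commP muln0.
  by rewrite invr1 subrr divr_ge0.
have [P [commP _]] := two_round_protocol (I := 'rV[nat]_1) (k := k) R tt
  (fun _ (_ : unit) => tt) card1 card1' tt tt (fun=> tt) (fun _ _ => tt)
  (fun _ _ => fset0 : {fset 'I_1 * R}) card1' card1'.
exists P => x _; split; first by move=> w; rewrite commP !addn0 muln0.
by rewrite invr1 subrr divr_ge0.
Qed.

Section Sizes.
Variables (R : realType) (p : R) (a b n : nat).
Hypotheses (hp : 2 <= p) (n2 : (1 < n)%N).

Definition log_size : nat := (trunc_log 2 n).+1.

Lemma log_size_ge : (n <= 2 ^ log_size)%N.
Proof. by rewrite ltnW// trunc_log_ltn. Qed.

(** For [n >= 2] both the integer part of [log2 n] and the added 1 are at most [log2 n]. *)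
Lemma log_size_le : log_size%:R <= 2 / ln 2 * ln n%:R :> R.
Proof.
have ln2 : 0 < ln 2 :> R by rewrite ln_gt0// ltr1n.
have n0 : (0 < n)%N by exact: ltn_trans n2.
rewrite mulrAC ler_pdivlMr// /log_size -natr1 mulrDl mul1r.
have : ln 2 <= ln n%:R :> R by rewrite ler_ln ?posrE ?ltr0n// ler_nat.
have : (trunc_log 2 n)%:R * ln 2 <= ln n%:R :> R.
  rewrite mulr_natl -lnXn// ler_ln ?posrE ?exprn_gt0 ?ltr0n//.
  by rewrite -natrX ler_nat trunc_logP.
by lra.
Qed.

Definition entry_size : nat := (a + log_size * b)%N.

Lemma entry_size_gt : (a * n ^ b < 2 ^ entry_size)%N.
Proof.
rewrite expnD expnM.
apply: leq_trans (_ : (a.+1 * n ^ b <= _)%N).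
  by rewrite mulSn -addn1 addnC leq_add2r expn_gt0 ltnW.
by apply: leq_mul; [exact: ltn_expl|exact: leq_expl log_size_ge].
Qed.

Definition coin_size : nat := (log_size + entry_size * (Num.truncn p).+1)%N.

Lemma coin_size_ge : (n * weight p (a * n ^ b) <= 2 ^ coin_size)%N.
Proof.
rewrite expnD; apply: leq_mul log_size_ge _.
rewrite -(ler_nat R) (le_trans (weight_le _ _))//.
apply: le_trans (_ : (2 ^ entry_size)%:R `^ p <= _).
  apply: ler_powRl; rewrite ?ler0n ?ler_nat//; first exact: le_trans hp.
  exact: ltnW entry_size_gt.
rewrite expnM [leRHS]natrX -powR_mulrn// ler_powR//; first by rewrite ler1n expn_gt0.
by apply/ltW/truncnS_gt.
Qed.

End Sizes.

Lemma entry_log_size_le (a b n : nat) :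
  (entry_size a b n + log_size n <= (1 + a + b) * log_size n ^ 3)%N.
Proof.
have l3 : (log_size n <= log_size n ^ 3)%N by rewrite expnS leq_pmulr// expn_gt0.
rewrite /entry_size addnC addnA !mulnDl mul1n !leq_add//.
  by rewrite leq_pmulr// expn_gt0.
by rewrite mulnC leq_mul2l l3 orbT.
Qed.

Definition size_factor (R : realType) (p : R) (a b : nat) : nat :=
  (6 + (a + b) * ((Num.truncn p).+1 + 3))%N.

Lemma digest_bits_le (R : realType) (p : R) (a b n T : nat) : (0 < T)%N ->
  (digest_bits (coin_size p a b n) (log_size n) T (entry_size a b n) <=
   size_factor p a b * log_size n ^ 3 * T)%N.
Proof.
move=> T0; rewrite /digest_bits /coin_size /size_factor.
set q := (Num.truncn p).+1; have l0 : (0 < log_size n)%N by [].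
have : (entry_size a b n <= log_size n * (a + b))%N.
  by rewrite /entry_size mulnDr leq_add2r leq_pmull.
move: (entry_size a b n) (log_size n) (a + b)%N l0 => m l s l0 ml.
(* As [m] is [O(l)], the [2lT] draws take [O(l^2 T)] bits and the rest [O(l)]; the sum is then
   bounded through [l^3 T]. *)
have llT : (l * l * T <= l ^ 3 * T)%N by rewrite leq_mul2r !expnS expn0 muln1 mulnA leq_pmulr ?orbT.
have lT : (l <= l * l * T)%N by rewrite -mulnA leq_pmulr// muln_gt0 l0.
have mq : (m * q <= l * s * q)%N by rewrite leq_mul2r ml orbT.
have msT : ((l + m).+1 * (l.*2 * T) <= (l + l * s + l) * (l.*2 * T))%N.
  by rewrite leq_mul2r; apply/orP; right; lia.
have -> : ((6 + s * (q + 3)) * l ^ 3 * T = (6 + s * (q + 3)) * (l ^ 3 * T))%N by rewrite mulnA.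
apply: leq_trans (_ : (6 + s * (q + 3)) * (l * l * T) <= _)%N; last by rewrite leq_mul2l llT orbT.
have : (l * s * (q + 1) <= l * l * T * (s * (q + 1)))%N.
  by rewrite -mulnA leq_mul2r lT orbT.
by rewrite -mul2n in msT *; nia.
Qed.

(** [T] is the first integer above [K * A], where [k * A = k^(p-1) / (alpha * eps^p)]. Since
    [A >= 1], rounding adds at most 1 to the constant [K]. *)
Lemma sample_size (R : realType) (p alpha eps : R) (k : nat) :
  2 <= p -> 0 < alpha < 1 -> 0 < eps < 1 -> (0 < k)%N ->
  exists T : nat, [/\ (0 < T)%N,
    (2048 * p) `^ p * k%:R `^ (p - 2) <= T%:R * (alpha * eps `^ p) &
    k%:R * T%:R <= ((2048 * p) `^ p + 1) * (k%:R `^ (p - 1) / (alpha * eps `^ p))].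
Proof.
move=> hp /andP[alpha0 alpha1] /andP[e0 e1] k0.
have k1 : 1 <= k%:R :> R by rewrite ler1n.
have k0' : 0 < k%:R :> R by rewrite ltr0n.
have ep0 : 0 < eps `^ p by rewrite powR_gt0.
have ae0 : 0 < alpha * eps `^ p by rewrite mulr_gt0.
set K := (2048 * p) `^ p; have K0 : 0 <= K by exact: powR_ge0.
set A := k%:R `^ (p - 2) / (alpha * eps `^ p).
have A1 : 1 <= A.
  rewrite ler_pdivlMr// mul1r; apply: le_trans (_ : 1 <= _).
    rewrite mulr_ile1 ?powR_ge0 ?(ltW alpha0) ?(ltW alpha1)//.
    apply: le_trans (_ : 1 `^ p <= _); last by rewrite powR1.
    by apply: ler_powRl; [lra|exact: ltW|exact: ltW].
  rewrite -[leLHS](powRr0 k%:R); apply: ler_powR => //; lra.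
have KA0 : 0 <= K * A by rewrite mulr_ge0// (le_trans _ A1).
exists (Num.truncn (K * A)).+1; have /andP[lo hi] := truncn_itv KA0; split=> //.
  rewrite -[leLHS](divfK (lt0r_neq0 ae0)) ler_pM2r// -mulrA; exact: ltW.
have -> : k%:R `^ (p - 1) / (alpha * eps `^ p) = k%:R * A.
  rewrite /A mulrA; congr (_ / _).
  have -> : p - 1 = 1 + (p - 2) by ring.
  rewrite (powRD (r := 1)); last by rewrite (gt_eqF k0') implybT.
  by rewrite powRr1// ltW.
rewrite [leRHS]mulrCA (ler_pM2l k0') -natr1 mulrDl mul1r.
exact: lerD.
Qed.

(* Entries are bounded by a * n ^ b; the constant C hidden in O(.) depends only
   on p and on the polynomial bound (a, b). *)
Theorem theorem6 (R : realType) (p : R) (a b : nat) (hp : 2 <= p) :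
  exists C : R, 0 < C /\
    forall (k n : nat) (alpha : R),
      (0 < k)%N -> (0 < n)%N -> 0 < alpha < 1 ->
      (exists P : protocol k 'rV[nat]_n {fset 'I_n * R},
         computes_cover 2 p (a * n ^ b)%N alpha 0
           (C / alpha)
           (C * (k%:R `^ (p - 1) / alpha * ln n%:R ^+ 3)) P) /\
      (forall eps : R, 0 < eps < 1 ->
       exists P : protocol k 'rV[nat]_n {fset 'I_n * R},
         computes_cover 1 p (a * n ^ b)%N alpha eps
           (C / alpha)
           (C * (k%:R `^ (p - 1) / (alpha * eps `^ p) * ln n%:R ^+ 3)) P).
Proof.
(* [c0] converts [log_size] into [ln]; [c1] pays for the digests, with [2^p] from accuracy 1/2 in
   the two-round protocol; [c2] pays for the second round, the last summand of [C] for the cover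
   size. *)
pose c0 : R := 2 / ln 2; pose K : R := (2048 * p) `^ p + 1.
pose c1 : R := (size_factor p a b)%:R * K.
pose c2 : R := (1 + a + b)%N%:R * (4 `^ p + 1).
pose C : R := c0 ^+ 3 * (c1 * 2 `^ p + c2) + (4 `^ p + 1).
have ln2 : 0 < ln 2 :> R by rewrite ln_gt0// ltr1n.
have c00 : 0 < c0 by rewrite divr_gt0.
have K0 : 0 <= K by rewrite addr_ge0 ?powR_ge0.
have c10 : 0 <= c1 by rewrite mulr_ge0.
have c20 : 0 <= c2 by rewrite mulr_ge0 ?addr_ge0 ?powR_ge0.
have two1 : 1 <= 2 `^ p :> R.
  rewrite -[leLHS](powRr0 2); apply: ler_powR; [by rewrite ler1n|lra].
have C4 : 4 `^ p + 1 <= C.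
  by rewrite /C lerDr mulr_ge0 ?exprn_ge0 ?(ltW c00)// addr_ge0// mulr_ge0// powR_ge0.
have C0 : 0 < C by rewrite (lt_le_trans _ C4)// ltr_wpDl ?powR_ge0.
exists C; split=> // k n alpha k0 n0 halpha; have /andP[alpha0 alpha1] := halpha.
case: (ltnP 1 n) => [n2|]; last first.
  move=> n1.
  have -> : n = 1%N by apply/eqP; rewrite eqn_leq n1.
  rewrite ln1 expr0n/= !mulr0.
  have CS : 0 <= C / alpha by rewrite divr_ge0 ?ltW.
  split; first by have [_] := silent_cover k p (a * 1 ^ b) alpha 0 CS.
  move=> eps _; rewrite !mulr0.
  by have [] := silent_cover k p (a * 1 ^ b) alpha eps CS.
have sizeC : (cover_size p alpha)%:R <= (4 `^ p + 1) / alpha.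
  have : 0 <= 4 `^ p / alpha by rewrite divr_ge0 ?powR_ge0// ltW.
  move=> /truncn_itv/andP[lo _]; rewrite /cover_size -natr1 mulrDl mul1r lerD//.
  by rewrite invf_ge1// ltW.
have sizeC' : (cover_size p alpha)%:R <= C / alpha.
  by apply: le_trans sizeC _; rewrite ler_pM2r ?invr_gt0.
set l : R := (log_size n)%:R.
have l3 : l ^+ 3 <= c0 ^+ 3 * ln n%:R ^+ 3.
  rewrite -exprMn lerXn2r ?nnegrE ?ler0n ?log_size_le//.
  by rewrite mulr_ge0 ?(ltW c00)// ln_ge0// ler1n.
have lnn3 : 0 <= ln n%:R ^+ 3 :> R by rewrite exprn_ge0// ln_ge0// ler1n.
have digestB (eps : R) (T : nat) : (0 < T)%N ->
   k%:R * T%:R <= K * (k%:R `^ (p - 1) / (alpha * eps `^ p)) ->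
   (k * digest_bits (coin_size p a b n) (log_size n) T (entry_size a b n))%:R <=
   c1 * (k%:R `^ (p - 1) / (alpha * eps `^ p)) * l ^+ 3.
  move=> T0 kT; apply: le_trans (_ : (k * (size_factor p a b * log_size n ^ 3 * T))%:R <= _).
    by rewrite ler_nat leq_mul2l digest_bits_le ?orbT.
  have -> : (k * (size_factor p a b * log_size n ^ 3 * T))%:R =
    ((size_factor p a b)%:R * (k%:R * T%:R)) * l ^+ 3.
    by rewrite /l -natrX -!natrM; congr _%:R; ring.
  rewrite ler_wpM2r ?exprn_ge0// /c1 -[leRHS]mulrA.
  by rewrite ler_wpM2l.
have j0 : 'I_n by exact: Ordinal n0.
have kp0 : 0 <= k%:R `^ (p - 1) :> R by exact: powR_ge0.
split.
  have half01 : (0 < (2^-1 : R)) && ((2^-1 : R) < 1).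
    by rewrite invr_gt0 ltr0n invf_lt1 ?ltr0n ?ltr1n.
  have [T [T0 largeT kT]] := sample_size hp halpha half01 k0.
  have [P HP] := two_round_cover j0 hp alpha0 half01 k0 T0 largeT
    (coin_size_ge a b hp n2) (log_size_ge n) (entry_size_gt a b n2).
  exists P; apply: computes_cover_mono sizeC' _ HP.
  set X := k%:R `^ (p - 1) / alpha.
  have X0 : 0 <= X by rewrite divr_ge0// ltW.
  have halfE : k%:R `^ (p - 1) / (alpha * 2^-1 `^ p) = 2 `^ p * X.
    have -> : 2 `^ p = (2^-1 `^ p)^-1 :> R.
      by rewrite -powRN -(@powR_inv1 R 2)// -powRrM mulrNN mul1r.
    by rewrite /X invfM; ring.
  have := digestB _ _ T0 kT; rewrite halfE => dB.
  rewrite -addnA mulnDr natrD -mulnDl.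
  have : (k * ((entry_size a b n + log_size n) * cover_size p alpha))%:R <=
      c2 * X * l ^+ 3.
    apply: le_trans (_ : k%:R * ((1 + a + b)%N%:R * l ^+ 3 * ((4 `^ p + 1) / alpha)) <= _).
      rewrite natrM ler_wpM2l// natrM ler_pM//.
      by rewrite /l -natrX -natrM ler_nat entry_log_size_le.
    rewrite /c2 /X.
    (* The second round costs a factor [k], at most [k^(p-1)] because [p >= 2]. *)
    have kk : k%:R <= k%:R `^ (p - 1) :> R.
      by rewrite le1r_powR// ?ler1n//; lra.
    have -> : k%:R * ((1 + a + b)%N%:R * l ^+ 3 * ((4 `^ p + 1) / alpha)) =
       ((1 + a + b)%N%:R * l ^+ 3 * ((4 `^ p + 1) / alpha)) * k%:R by ring.
    have -> : (1 + a + b)%N%:R * (4 `^ p + 1) * (k%:R `^ (p - 1) / alpha) * l ^+ 3 =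
      ((1 + a + b)%N%:R * l ^+ 3 * ((4 `^ p + 1) / alpha)) * k%:R `^ (p - 1) by ring.
    rewrite ler_wpM2l// mulr_ge0 ?mulr_ge0 ?exprn_ge0// ?invr_ge0 ?(ltW alpha0)//.
    by rewrite addr_ge0 ?powR_ge0.
  move=> sB; apply: le_trans (lerD dB sB) _.
  have -> : c1 * (2 `^ p * X) * l ^+ 3 + c2 * X * l ^+ 3 =
    (c1 * 2 `^ p + c2) * X * l ^+ 3 by ring.
  apply: le_trans (_ : (c1 * 2 `^ p + c2) * X * (c0 ^+ 3 * ln n%:R ^+ 3) <= _).
    by rewrite ler_wpM2l// mulr_ge0// addr_ge0// mulr_ge0// powR_ge0.
  have -> : (c1 * 2 `^ p + c2) * X * (c0 ^+ 3 * ln n%:R ^+ 3) =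
    c0 ^+ 3 * (c1 * 2 `^ p + c2) * (X * ln n%:R ^+ 3) by ring.
  rewrite ler_wpM2r//; first exact: mulr_ge0.
  by rewrite -[leLHS]addr0 lerD// addr_ge0 ?powR_ge0.
move=> eps eps01; have /andP[e0 e1] := eps01.
have [T [T0 largeT kT]] := sample_size hp halpha eps01 k0.
have [P HP] := one_round_cover j0 hp alpha0 eps01 k0 T0 largeT
  (coin_size_ge a b hp n2) (log_size_ge n) (entry_size_gt a b n2).
exists P; apply: computes_cover_mono sizeC' _ HP.
apply: le_trans (digestB _ _ T0 kT) _.
set Y := k%:R `^ (p - 1) / _.
have Y0 : 0 <= Y by rewrite divr_ge0// mulr_ge0 ?powR_ge0// ltW.
apply: le_trans (_ : c1 * Y * (c0 ^+ 3 * ln n%:R ^+ 3) <= _).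
  by rewrite ler_wpM2l// mulr_ge0.
have -> : c1 * Y * (c0 ^+ 3 * ln n%:R ^+ 3) = c0 ^+ 3 * c1 * (Y * ln n%:R ^+ 3) by ring.
rewrite ler_wpM2r//; first exact: mulr_ge0.
rewrite /C; have : c0 ^+ 3 * c1 <= c0 ^+ 3 * (c1 * 2 `^ p + c2).
  rewrite ler_wpM2l ?exprn_ge0 ?(ltW c00)//.
  by rewrite -[leLHS]addr0 lerD// ler_peMr.
by have := powR_ge0 (4 : R) p; lra.
Qed.
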